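(* Let $\Omega$ be a connected $k$-orbigraph with $n$ vertices, let $A$ be its adjacency matrix with eigenvalues $\lambda_1,\dots,\lambda_n$ (listed with multiplicity), and let $s$ be the number of singular vertices of $\Omega$. Then $$\frac{\sum_{i=1}^n \lambda_i^2 - nk}{k^2-k} \le s \le \sum_{i=1}^n \lambda_i^2 - nk.$$
   Context: A $k$-orbigraph is a finite weighted directed graph $\Omega$ (loops allowed) on vertices $v_1,\dots,v_n$ whose adjacency matrix $A$ ($A_{ij}$ = weight of the directed edge $(v_i,v_j)$, $0$ if absent) satisfies: $A_{ij}\in\mathbb{Z}_{\ge 0}$; $\sum_j A_{ij}=k$ for every $i$; and $A_{ij}>0$ iff $A_{ji}>0$. It is connected if its underlying graph is connected. A vertex $v$ of an orbigraph is singular if some outgoing edge from $v$ has weight greater than one; otherwise it is regular. *)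

(* Defs.v *)
From mathcomp Require Import all_boot all_order all_algebra.

Set Implicit Arguments.
Unset Strict Implicit.
Unset Printing Implicit Defensive.

Import Order.TTheory GRing.Theory Num.Theory.

(* A weighted digraph on the vertices 'I_n is given by its adjacency matrix;
   weight 0 means that the edge is absent.  Taking the entries in nat encodes
   the requirement that they be nonnegative integers. *)
Record orbigraph (k n : nat) := Orbigraph {
  adjmx :> 'M[nat]_n;
  adjmx_row_sum : forall i, \sum_(j < n) adjmx i j = k;
  adjmx_support_sym : forall i j, (0 < adjmx i j) = (0 < adjmx j i)
}.

Definition underlying_edge (k n : nat) (W : orbigraph k n) : rel 'I_n :=
  fun i j => (0 < W i j) || (0 < W j i).

Definition connected_orbigraph (k n : nat) (W : orbigraph k n) : Prop :=
  forall i j : 'I_n, connect (underlying_edge W) i j.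

Definition singular (k n : nat) (W : orbigraph k n) : pred 'I_n :=
  fun i => [exists j, 1 < W i j].

Local Open Scope ring_scope.

Definition adjmx_in (C : nzRingType) (k n : nat) (W : orbigraph k n) :
    'M[C]_n :=
  \matrix_(i, j) (W i j)%:R.

(* The family lam lists the n eigenvalues of B with algebraic multiplicity. *)
Definition eigenvalue_list (C : numClosedFieldType) (n : nat) (B : 'M[C]_n)
    (lam : 'I_n -> C) : Prop :=
  char_poly B = \prod_(i < n) ('X - (lam i)%:P).

(* Main.v *)
Require Import Defs.
From mathcomp Require Import all_boot all_order all_algebra.

Import Order.TTheory GRing.Theory Num.Theory.
Local Open Scope ring_scope.

(** The sum of the squared eigenvalues is tr(A^2) = sum_(i,j) A_ij A_ji.
    Since A_ij and A_ji vanish simultaneously, A_ij A_ji = A_ji + A_ji (A_ij - 1)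
    with truncated subtraction, so tr(A^2) - nk is the sum over i of
    e_i = sum_j A_ji (A_ij - 1).  Here e_i = 0 if i is regular, and
    1 <= e_i <= k (k - 1) if i is singular. *)

(** Since ['X%:M] is scalar, it commutes with [P], so conjugating [A] conjugates the whole
    characteristic matrix, and the determinants of [P] and its inverse cancel. *)
Lemma char_poly_conj (F : fieldType) (n : nat) (P A : 'M[F]_n) :
  P \in unitmx -> char_poly (P *m A *m invmx P) = char_poly A.
Proof.
move=> Pu; have PV : map_mx polyC P *m map_mx polyC (invmx P) = 1%:M.
  by rewrite -map_mxM mulmxV // map_mx1.
rewrite /char_poly.
have -> : char_poly_mx (P *m A *m invmx P) =
    map_mx polyC P *m char_poly_mx A *m map_mx polyC (invmx P).
  rewrite /char_poly_mx !map_mxM mulmxBr mulmxBl scalar_mxC.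
  by rewrite -(mulmxA 'X%:M) PV mulmx1.
by rewrite !det_mulmx mulrAC -det_mulmx PV det1 mul1r.
Qed.

(** For [j != i], one of [T i j] and [T j i] lies above the diagonal and vanishes. *)
Lemma mxtrace_sqr_trig (R : pzRingType) (n : nat) (T : 'M[R]_n) :
  is_trig_mx T -> \tr (T *m T) = \sum_(i < n) T i i ^+ 2.
Proof.
move=> /is_trig_mxP Tt; apply: eq_bigr => i _.
rewrite mxE (bigD1 i) //= big1 ?addr0 // => j ji.
have [ij | ij | /val_inj eij] := ltngtP i j.
- by rewrite Tt ?mul0r.
- by rewrite (Tt j i) ?mulr0.
- by rewrite eij eqxx in ji.
Qed.

Lemma sum_sqr_eigenvalues (C : numClosedFieldType) (n : nat) (B : 'M[C]_n)
    (lam : 'I_n -> C) :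
  eigenvalue_list B lam -> \sum_(i < n) lam i ^+ 2 = \tr (B *m B).
Proof.
rewrite /eigenvalue_list.
(* Schur triangularization is stated for positive dimension. *)
case: n => [|n] in B lam * => Blam; first by rewrite /mxtrace !big_ord0.
have [P /unitarymx_unit Pu] := Schur B isT.
set T := conjmx P B => Ttrig; have Tdef : T = P *m B *m invmx P.
  exact: conjumx.
have -> : \tr (B *m B) = \tr (T *m T).
  by rewrite Tdef !mulmxA mulmxKV // [RHS]mxtrace_mulC !mulmxA mulVmx // mul1mx.
rewrite mxtrace_sqr_trig //.
(* Both families split the same characteristic polynomial into monic linear factors, so they agree
   up to order. *)
have : perm_eq [seq lam i | i <- index_enum 'I_n.+1]
                [seq T i i | i <- index_enum 'I_n.+1].
  apply: prod_XsubC_eq; rewrite !big_map -Blam.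
  by rewrite -(char_poly_trig Ttrig) -/T Tdef char_poly_conj.
move=> perm_lam; pose sqr (x : C) := x ^+ 2.
rewrite -(big_map lam xpredT sqr) -(big_map (fun i => T i i) xpredT sqr).
exact: perm_big.
Qed.

Section Excess.

Variables (k n : nat) (W : orbigraph k n).
Local Open Scope nat_scope.

Definition excess (i : 'I_n) : nat := \sum_(j < n) W j i * (W i j).-1.

Lemma sum_mul_adjmx :
  \sum_(i < n) \sum_(j < n) W i j * W j i = n * k + \sum_(i < n) excess i.
Proof.
(* The total weight is taken with transposed indices to match the factor [W j i] of [excess] term by
   term. *)
have -> : n * k = \sum_(i < n) \sum_(j < n) W j i.
  rewrite exchange_big /= (eq_bigr (fun=> k)) => [|i _].
    by rewrite sum_nat_const card_ord.
  exact: adjmx_row_sum.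
rewrite -big_split; apply: eq_bigr => i _.
rewrite -big_split; apply: eq_bigr => j _ /=.
have := adjmx_support_sym W i j.
case: (W i j) => [|a] => [/esym/eqP | _]; first by case: (W j i).
by rewrite /= mulnC mulnS.
Qed.

(** An edge with [W i j > 1] has a reverse edge, so its term [W j i * (W i j).-1] is positive. *)
Lemma excess_ge i : singular W i <= excess i.
Proof.
case sing_i: (singular W i) => //.
have /existsP[j Wij] := sing_i.
rewrite /excess (bigD1 j) //= ltn_addr // muln_gt0.
by rewrite (adjmx_support_sym W j i); case: (W i j) Wij => [|[]].
Qed.

Lemma leq_adjmx i j : W i j <= k.
Proof.
by apply: leq_trans (eq_leq (adjmx_row_sum W i)); rewrite (bigD1 j) //= leq_addr.
Qed.

(** Bounding each [W j i] by [k] leaves the sum of the [(W i j).-1]. A heavy entry loses one there,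
    so this sum is at most [k.-1]. At a regular vertex every [(W i j).-1] is zero. *)
Lemma excess_le i : excess i <= singular W i * (k * k.-1).
Proof.
case sing_i: (singular W i); last first.
  rewrite /excess big1 // => j _; apply/eqP.
  move/negbT: sing_i; rewrite negb_exists => /forallP/(_ j).
  by rewrite -leqNgt; case: (W i j) => [|[]] //=; rewrite muln0.
have /existsP[j Wij] := sing_i.
rewrite mul1n; apply: (@leq_trans (k * \sum_(l < n) (W i l).-1)).
  rewrite big_distrr; apply: leq_sum => l _; rewrite leq_mul2r.
  by rewrite leq_adjmx orbT.
have -> : k.-1 = (\sum_(l < n) W i l).-1 by rewrite adjmx_row_sum.
rewrite leq_mul2l !(bigD1 j (P := xpredT)) //=.
case: (W i j) Wij => // a _; rewrite addSn /= leq_add2l.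
by apply/orP; right; apply: leq_sum => l _; apply: leq_pred.
Qed.

Lemma card_singular :
  #|[set i | singular W i]| = \sum_(i < n) singular W i.
Proof. by rewrite cardsE -sum1_card big_mkcond. Qed.

End Excess.

Arguments excess {k n} W i.

Theorem theorem6p6 (C : numClosedFieldType) (k n : nat) (W : orbigraph k n)
    (W_connected : connected_orbigraph W)
    (lam : 'I_n -> C)
    (lam_eigenvalues : eigenvalue_list (adjmx_in C W) lam) :
  let s := #|[set i | singular W i]| in
  (\sum_(i < n) lam i ^+ 2 - n%:R * k%:R) / (k%:R ^+ 2 - k%:R) <= s%:R
    <= \sum_(i < n) lam i ^+ 2 - n%:R * k%:R.
Proof.
cbv zeta; have -> : \sum_(i < n) lam i ^+ 2 - n%:R * k%:R =
    (\sum_(i < n) excess W i)%N%:R.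
  rewrite (sum_sqr_eigenvalues _ _ _ _ lam_eigenvalues) -natrM.
  apply/(canLR (addrK _)); rewrite addrC -natrD -sum_mul_adjmx natr_sum.
  apply: eq_bigr => i _; rewrite mxE natr_sum.
  by apply: eq_bigr => j _; rewrite !mxE natrM.
(* The case [k = 0] is separate because [k.-1] truncates. *)
have -> : k%:R ^+ 2 - k%:R = (k * k.-1)%N%:R :> C.
  by case: (k) => [|m]; [rewrite expr0n subrr |
    rewrite natrM expr2 -[X in _ - X]mulr1 -mulrBr -[in X in _ * X]natr1 addrK].
rewrite card_singular ler_nat leq_sum ?andbT => [|i _]; last exact: excess_ge.
(* For k <= 1 the denominator vanishes and x / 0 = 0. *)
have [-> | kk_gt0] := posnP (k * k.-1)%N; first by rewrite invr0 mulr0 ler0n.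
rewrite ler_pdivrMr ?ltr0n // -natrM ler_nat big_distrl /=.
by apply: leq_sum => i _; apply: excess_le.
Qed.
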